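(* Let $G=(V,E)$ be a network graph with local dimension $d\ge 2$, let $(w_T)_{T\subseteq E}$ be real numbers, and let $$W=\sum_{T\subseteq E}w_T\,\bigotimes_{e\in T}\Phi_e\otimes\bigotimes_{e\in E\setminus T}(\mathbb{I}_e-\Phi_e).$$ Then $W$ is a sub-symmetric witness (SSW) for $G$ if and only if for every nontrivial subset $S$ of $V$ there exist real numbers $q_T(S)$, $T\subseteq E$, with $q_T(S)\le w_T$ for all $T\subseteq E$, such that $$\sum_{T\subseteq T(S)} q_{T\cup\tilde T}(S)\,\mathbf{x}_T(S)\ \ge\ 0\qquad\text{for all }\tilde T\subseteq E\setminus T(S),$$ where $$\mathbf{x}_T(S)=\bigotimes_{e\in T}(1,-1)\otimes\bigotimes_{e\in T(S)\setminus T}(d-1,d+1)\in\mathbb{R}^{2^{|T(S)|}}$$ (the tensor factor $\mathbb{R}^2$ belonging to each edge of $T(S)$ being placed at the position of that edge in a fixed ordering of $T(S)$), and the inequality is componentwise.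
   Context: Network: $G=(V,E)$ is a finite connected simple undirected graph with $|V|\ge2$; vertices are parties. To each edge $e=\{u,v\}$ is attached $\mathcal{H}_e=\mathbb{C}^d\otimes\mathbb{C}^d$, one tensor factor held by $u$ and the other by $v$; the network Hilbert space is $\bigotimes_{e\in E}\mathcal{H}_e$, and each party $v$ holds all factors located at $v$. $\mathbb{I}_e$ is the identity on $\mathcal{H}_e$ and $\Phi_e=|\phi^+\rangle\langle\phi^+|$ with $|\phi^+\rangle=\frac1{\sqrt d}\sum_{i=0}^{d-1}|ii\rangle\in\mathcal{H}_e$. A subset $S\subseteq V$ is nontrivial if $S\neq\emptyset$ and $S\ne V$. $\Gamma_S$ denotes the partial transpose (in the computational basis) on all tensor factors held by parties in $S$. A Hermitian operator $W$ is fully decomposable if for every nontrivial $S\subseteq V$ there exist positive semidefinite $P_S,Q_S$ with $W=P_S+Q_S^{\Gamma_S}$. A sub-symmetric witness (SSW) for $G$ is a fully decomposable operator of the form $\sum_{T\subseteq E}w_T\bigotimes_{e\in T}\Phi_e\otimes\bigotimes_{e\notin T}(\mathbb{I}_e-\Phi_e)$ with $w_T\in\mathbb{R}$. For nontrivial $S\subseteq V$, $T(S)\subseteq E$ is the set of edges with exactly one endpoint in $S$. *)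

(* Defs.v *)
From mathcomp Require Import all_boot all_order all_algebra.
From mathcomp Require Import reals.
From mathcomp.real_closed Require Import complex mxtens.

Set Implicit Arguments.
Unset Strict Implicit.
Unset Printing Implicit Defensive.

Import Order.TTheory GRing.Theory Num.Theory.

Local Open Scope ring_scope.
Local Open Scope complex_scope.
Local Open Scope sesquilinear_scope.

(* An undirected edge {u, v} is represented by the one of (u, v) and (v, u)
   that lists its endpoints in the order of the enumeration of V.  The first
   factor of H_e is held by the first endpoint, the second by the second; since
   |phi^+> is invariant under the swap, this choice is immaterial. *)
Definition edge (V : finType) (adj : rel V) :=
  {p : V * V | adj p.1 p.2 && (enum_rank p.1 < enum_rank p.2)%N}.

Definition nontrivial (V : finType) (S : {set V}) :=
  (S != set0) && (S != [set: V]).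

(* T(S) *)
Definition cut (V : finType) (adj : rel V) (S : {set V}) : {set edge adj} :=
  [set e | ((val e).1 \in S) (+) ((val e).2 \in S)].

(* The tensor product of a family of m x n matrices over a finite index set I.
   Its rows (columns) are labelled, through enum_val, by the families of row
   (column) indices of the factors; this fixes an ordering of the product
   basis without choosing an ordering of I. *)
Definition bigtens (K : comPzRingType) (I : finType) (m n : nat)
    (A : I -> 'M[K]_(m, n)) :
    'M[K]_(#|{: {ffun I -> 'I_m}}|, #|{: {ffun I -> 'I_n}}|) :=
  \matrix_(i, j) \prod_(k : I)
    A k ((enum_val i : {ffun I -> 'I_m}) k) ((enum_val j : {ffun I -> 'I_n}) k).

(* Operators on the network Hilbert space, as matrices in the computational
   basis.  A basis vector is a family x with x e : 'I_(d * d), and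
   mxtens_unindex (x e) is the pair of labels of its two factors at e. *)
Notation netop R adj d :=
  ('M[R[i]]_(#|{: {ffun edge adj -> 'I_(d * d)}}|)).

Definition phi_plus (R : realType) (d : nat) : 'M[R[i]]_(d * d, 1 * 1) :=
  ((Num.sqrt d%:R)^-1)%:C *:
    \sum_(i < d) (delta_mx i 0 : 'cV_d) *t (delta_mx i 0 : 'cV_d).

Definition Phi (R : realType) (d : nat) : 'M[R[i]]_(d * d) :=
  phi_plus R d *m (phi_plus R d)^t*.

Definition subsym_op (R : realType) (V : finType) (adj : rel V) (d : nat)
    (w : {set edge adj} -> R) : netop R adj d :=
  \sum_(T : {set edge adj})
    (w T)%:C *: bigtens (fun e => if e \in T then Phi R d else 1%:M - Phi R d).

(* The labels of x, with those of the factors held by S replaced by y's. *)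
Definition swap_labels (V : finType) (adj : rel V) (d : nat) (S : {set V})
    (x y : {ffun edge adj -> 'I_(d * d)}) : {ffun edge adj -> 'I_(d * d)} :=
  [ffun e =>
    let a := mxtens_unindex (x e) in
    let b := mxtens_unindex (y e) in
    mxtens_index (if (val e).1 \in S then b.1 else a.1,
                  if (val e).2 \in S then b.2 else a.2)].

(* <x| A^Gamma_S |y> = <x'| A |y'>, where x' and y' are obtained from x and y
   by exchanging their labels at the factors held by S. *)
Definition ptrans (R : realType) (V : finType) (adj : rel V) (d : nat)
    (S : {set V}) (A : netop R adj d) : netop R adj d :=
  \matrix_(i, j)
    A (enum_rank (swap_labels S (enum_val i) (enum_val j)))
      (enum_rank (swap_labels S (enum_val j) (enum_val i))).

Definition psdmx (R : realType) (n : nat) (A : 'M[R[i]]_n) : Prop :=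
  A \is hermsymmx /\ forall v : 'cV[R[i]]_n, 0 <= (v^t* *m A *m v) 0 0.

Definition fully_decomposable (R : realType) (V : finType) (adj : rel V)
    (d : nat) (W : netop R adj d) : Prop :=
  W \is hermsymmx /\
  forall S : {set V}, nontrivial S ->
    exists P Q : netop R adj d, [/\ psdmx P, psdmx Q & W = P + ptrans S Q].

Definition is_SSW (R : realType) (V : finType) (adj : rel V) (d : nat)
    (W : netop R adj d) : Prop :=
  fully_decomposable W /\
  exists w : {set edge adj} -> R, W = subsym_op d w.

Definition row2 (R : realType) (a b : R) : 'rV[R]_2 :=
  \row_(j < 2) (if j == 0 then a else b).

(* x_T(S); as a tensor product of row vectors it has a single row. *)
Definition xvec (R : realType) (V : finType) (adj : rel V) (d : nat)
    (S : {set V}) (T : {set edge adj}) :=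
  bigtens (fun e : {e : edge adj | e \in cut adj S} =>
    if val e \in T then row2 1 (-1) else row2 (d%:R - 1) (d%:R + 1) : 'rV[R]_2).

(* Main.v *)
(* Transposing one factor of an edge turns Phi into F / d, F the flip, so that
   Phi^Gamma and (I - Phi)^Gamma are 1/d times the combinations with
   coefficients (1, -1) and (d - 1, d + 1) of the symmetric and antisymmetric
   projectors.  On the edges that S does not cut, Gamma_S fixes both operators.
   Hence the coefficients of W^Gamma_S over the product projectors are, up to a
   positive factor, the components of the vectors of the theorem, and numbers
   q_T satisfying the conditions give a decomposition with
   Q = (sum_T q_T Phi_T)^Gamma_S and P = W - Q^Gamma_S.  Conversely, if
   W = P + Q^Gamma_S, take q_T = tr(Q^Gamma_S Phi_T) / tr(Phi_T).  Then
   w_T - q_T = tr(P Phi_T) / tr(Phi_T) is nonnegative, and since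
     Phi^Gamma + (I - Phi)^Gamma / (d + 1) = 2 / (d + 1) * sym,
   - Phi^Gamma + (I - Phi)^Gamma / (d - 1) = 2 / (d - 1) * antisym,
   the conditions say that Q has nonnegative trace against the product
   projectors: no twirling of P and Q is needed. *)
Require Import Defs.
From mathcomp Require Import all_boot all_order all_algebra.
From mathcomp Require Import reals.
From mathcomp Require Import ring.
From mathcomp.real_closed Require Import complex mxtens.

Set Implicit Arguments.
Unset Strict Implicit.
Unset Printing Implicit Defensive.

Import Order.TTheory GRing.Theory Num.Theory.
Local Open Scope ring_scope.
Local Open Scope sesquilinear_scope.

Lemma set_neqP (I : finType) (A B : {set I}) :
  A <> B -> exists e, (e \in A) != (e \in B).
Proof.
move=> AB; apply/existsP; apply: contraT; rewrite negb_exists => /forallP h.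
by case: AB; apply/setP => e; apply/eqP; move: (h e); rewrite negbK.
Qed.

(** * Tensor products over a finite index set *)

Section BigTens.
Context {K : comPzRingType} {I : finType}.

Lemma eq_bigtens m n (A B : I -> 'M[K]_(m, n)) :
  A =1 B -> bigtens A = bigtens B.
Proof.
move=> AB; apply/matrixP=> i j; rewrite !mxE.
by apply: eq_bigr => k _; rewrite AB.
Qed.

Lemma bigtens_mul m n p (A : I -> 'M[K]_(m, n)) (B : I -> 'M[K]_(n, p)) :
  bigtens A *m bigtens B = bigtens (fun k => A k *m B k).
Proof.
apply/matrixP=> i j; rewrite !mxE.
under [RHS]eq_bigr do rewrite mxE.
rewrite bigA_distr_bigA /= (reindex (@enum_val _ {: {ffun I -> 'I_n}})) /=.
  by apply: eq_bigr => k _; rewrite !mxE big_split.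
by apply: onW_bij; apply: enum_val_bij.
Qed.

Lemma mxtrace_bigtens n (A : I -> 'M[K]_n) :
  \tr (bigtens A) = \prod_k \tr (A k).
Proof.
rewrite bigA_distr_bigA /= (reindex (@enum_val _ {: {ffun I -> 'I_n}})) /=.
  by apply: eq_bigr => k _; rewrite !mxE.
by apply: onW_bij; apply: enum_val_bij.
Qed.

Lemma bigtensZ m n (c : I -> K) (A : I -> 'M[K]_(m, n)) :
  bigtens (fun k => c k *: A k) = (\prod_k c k) *: bigtens A.
Proof.
apply/matrixP=> i j; rewrite !mxE -big_split.
by apply: eq_bigr => k _; rewrite mxE.
Qed.

(** Distributivity: [T] collects the factors at which the [true] summand is chosen. Every expansion
    over sets of edges below comes from this. *)
Lemma bigtens_sum_bool m n (A : I -> bool -> 'M[K]_(m, n)) :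
  bigtens (fun k => A k true + A k false) =
  \sum_(T : {set I}) bigtens (fun k => A k (k \in T)).
Proof.
apply/matrixP=> i j; rewrite !mxE summxE.
under eq_bigr do rewrite mxE.
rewrite bigA_distr; apply: eq_big => // T _; rewrite !mxE.
by apply: eq_bigr => k _; case: ifP.
Qed.

End BigTens.

(** * Orthogonal projectors and positivity *)

Section Psd.
Context {R : realType}.
Local Notation C := R[i].

Lemma bigtens_adj (I : finType) m n (A : I -> 'M[C]_(m, n)) :
  (bigtens A)^t* = bigtens (fun k => (A k)^t*).
Proof.
apply/matrixP=> i j; rewrite !mxE rmorph_prod.
by apply: eq_bigr => k _; rewrite !mxE.
Qed.

Definition orthoproj n (A : 'M[C]_n) := A^t* = A /\ A *m A = A.

Lemma orthoproj_bigtens (I : finType) n (A : I -> 'M[C]_n) :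
  (forall k, orthoproj (A k)) -> orthoproj (bigtens A).
Proof.
move=> pA; split.
  by rewrite bigtens_adj; apply: eq_bigtens => k; case: (pA k).
by rewrite bigtens_mul; apply: eq_bigtens => k; case: (pA k).
Qed.

Lemma mulmx_adj_ge0 n (v : 'cV[C]_n) : 0 <= (v^t* *m v) 0 0.
Proof.
rewrite mxE; apply: sumr_ge0 => k _; rewrite !mxE mulrC; exact: mul_conjC_ge0.
Qed.

Lemma hermsymmxP n (A : 'M[C]_n) : A^t* = A -> A \is hermsymmx.
Proof. by move=> h; apply/is_hermitianmxP; rewrite expr0 scale1r h. Qed.

Lemma hermsymmx_sum_orthoproj (J : finType) n (c : J -> C) (A : J -> 'M[C]_n) :
  (forall k, c k \is Num.real) -> (forall k, orthoproj (A k)) ->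
  \sum_k c k *: A k \is hermsymmx.
Proof.
move=> cR pA; apply: hermsymmxP; apply/matrixP=> i j.
rewrite !mxE !summxE rmorph_sum.
apply: eq_bigr => k _; rewrite !mxE rmorphM /= (conj_Creal (cR k)).
by congr (_ * _); case: (pA k) => [/matrixP/(_ i j)]; rewrite !mxE.
Qed.

Lemma psdmx_sum_orthoproj (J : finType) n (c : J -> C) (A : J -> 'M[C]_n) :
  (forall k, 0 <= c k) -> (forall k, orthoproj (A k)) ->
  psdmx (\sum_k c k *: A k).
Proof.
move=> c0 pA; split.
  by apply: hermsymmx_sum_orthoproj => // k; apply: ger0_real.
move=> v; rewrite mulmx_sumr mulmx_suml summxE; apply: sumr_ge0 => k _.
rewrite -scalemxAr -scalemxAl mxE; apply: mulr_ge0 => //.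
have [hA AA] := pA k.
(* As [A] equals its adjoint times itself, the form is the squared norm of [A *m v]. *)
rewrite -AA -{1}hA !mulmxA -map_mxM -trmx_mul -mulmxA; exact: mulmx_adj_ge0.
Qed.

(** By cyclicity tr(QA) = tr(AQA), and the diagonal entries of AQA are the values of the form of [Q]
    at the columns of [A]. *)
Lemma mxtrace_psd_orthoproj n (Q A : 'M[C]_n) :
  psdmx Q -> orthoproj A -> 0 <= \tr (Q *m A).
Proof.
move=> [_ Q0] [hA AA]; rewrite -AA mulmxA mxtrace_mulC mulmxA.
apply: sumr_ge0 => k _.
suff -> : (A *m Q *m A) k k = ((col k A)^t* *m Q *m col k A) 0 0 by [].
have -> : (col k A)^t* = row k A.
  by apply/matrixP=> i j; rewrite -{2}hA !mxE.
by rewrite -row_mul !mxE; apply: eq_bigr => j _; rewrite !mxE.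
Qed.

End Psd.

(** * Partial transposition on a single edge *)

Section PartialTranspose.
Context {K : pzRingType} {d : nat}.

(** The one-edge form of [swap_labels]: [a] and [b] tell whether the first and the second factor are
    transposed. *)
Definition pt_label (a : bool) (x y : 'I_(d * d)) (b : bool) :=
  mxtens_index (if a then (mxtens_unindex y).1 else (mxtens_unindex x).1,
                if b then (mxtens_unindex y).2 else (mxtens_unindex x).2).

Definition ptmx (a b : bool) (M : 'M[K]_(d * d)) : 'M[K]_(d * d) :=
  \matrix_(x, y) M (pt_label a x y b) (pt_label a y x b).

Lemma ptmx1 a b : ptmx a b 1%:M = 1%:M.
Proof.
apply/matrixP=> x y.
rewrite !mxE -2!(can_eq (@mxtens_unindexK d d)) !mxtens_indexK.
case: (mxtens_unindex x) (mxtens_unindex y) => [x1 x2] [y1 y2].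
by case: a; case: b; rewrite !xpair_eqE ?(eq_sym y1) ?(eq_sym y2).
Qed.

Lemma ptmxB a b : {morph ptmx a b : M N / M - N}.
Proof. by move=> M N; apply/matrixP=> x y; rewrite !mxE. Qed.

Definition flipmx : 'M[K]_(d * d) :=
  \matrix_(x, y) (((mxtens_unindex x).1 == (mxtens_unindex y).2) &&
                  ((mxtens_unindex x).2 == (mxtens_unindex y).1))%:R.

Lemma flipmxK : flipmx *m flipmx = 1%:M.
Proof.
apply/matrixP=> x y; rewrite !mxE.
pose z := mxtens_index ((mxtens_unindex x).2, (mxtens_unindex x).1).
rewrite (bigD1 z) //= big1 ?addr0 => [|k kz].
  rewrite !mxE mxtens_indexK /= !eqxx mul1r andbC.
  by rewrite -(can_eq (@mxtens_unindexK d d)) -pair_eqE.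
rewrite !mxE; case: andP => [[/eqP h1 /eqP h2]|_]; last by rewrite mul0r.
by case/eqP: kz; rewrite /z h1 h2 -surjective_pairing mxtens_unindexK.
Qed.

End PartialTranspose.

(** * Partial transposition on the network *)

Section Ptrans.
Context {R : realType} {V : finType} {adj : rel V} {d : nat}.
Variable S : {set V}.
Implicit Types A B : netop R adj d.

Lemma ptrans_bigtens (A : edge adj -> 'M[R[i]]_(d * d)) :
  ptrans S (bigtens A) =
  bigtens (fun e => ptmx ((val e).1 \in S) ((val e).2 \in S) (A e)).
Proof.
apply/matrixP=> i j; rewrite !mxE.
by apply: eq_bigr => e _; rewrite !enum_rankK !ffunE !mxE.
Qed.

Lemma swap_labelsK (x y : {ffun edge adj -> 'I_(d * d)}) :
  swap_labels S (swap_labels S x y) (swap_labels S y x) = x.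
Proof.
apply/ffunP=> e; rewrite !ffunE !mxtens_indexK -[RHS]mxtens_unindexK.
by congr mxtens_index; case: (_ \in S); case: (_ \in S).
Qed.

Lemma ptransK : involutive (@ptrans R V adj d S).
Proof.
move=> A; apply/matrixP=> i j.
by rewrite !mxE !enum_rankK !swap_labelsK !enum_valK.
Qed.

Lemma ptrans_sumZ (J : finType) (c : J -> R[i]) (A : J -> netop R adj d) :
  ptrans S (\sum_k c k *: A k) = \sum_k c k *: ptrans S (A k).
Proof.
apply/matrixP=> i j; rewrite !mxE !summxE.
by apply: eq_bigr => k _; rewrite !mxE.
Qed.

(** Gamma_S permutes the matrix positions by an involution that commutes with exchanging row and
    column, so reindexing the double sum moves it to the other factor. *)
Lemma mxtrace_ptrans A B : \tr (ptrans S A *m B) = \tr (A *m ptrans S B).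
Proof.
rewrite /mxtrace.
under eq_bigr do rewrite mxE.
under [RHS]eq_bigr do rewrite mxE.
rewrite !pair_bigA /=.
pose sw (x y : 'I_#|{: {ffun edge adj -> 'I_(d * d)}}|) :=
  enum_rank (swap_labels S (enum_val x) (enum_val y)).
have swK x y : sw (sw x y) (sw y x) = x.
  by rewrite /sw !enum_rankK swap_labelsK enum_valK.
pose f p := (sw p.1 p.2, sw p.2 p.1).
have fK : involutive f by case=> x y; rewrite /f /= !swK.
rewrite (reindex_inj (inv_inj fK)) /=; apply: eq_bigr => -[x y] _.
by rewrite !mxE -/(sw _ _) -/(sw _ _) /= -/(sw _ _) -/(sw _ _) !swK.
Qed.

End Ptrans.

(** * The maximally entangled projector on one edge *)

Section EdgeOperators.
Context {R : realType} {d : nat}.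
Local Notation C := R[i].

Lemma phi_plusE x (j : 'I_(1 * 1)) : phi_plus R d x j =
  ((Num.sqrt d%:R)^-1)%:C%C * ((mxtens_unindex x).1 == (mxtens_unindex x).2)%:R.
Proof.
have -> : j = 0 by apply: val_inj; case: j => -[].
rewrite mxE summxE; congr (_ * _).
under eq_bigr => k _ do rewrite !mxE !andbT -natrM mulnb.
case: eqP => [e|ne]; last first.
  rewrite big1 // => k _; case: andP => // -[/eqP h1 /eqP h2].
  by case: ne; rewrite h1 h2.
rewrite (bigD1 (mxtens_unindex x).1) // -e !eqxx big1 => [|k]; first exact: addr0.
by rewrite eq_sym => /negPf ->.
Qed.

Lemma sqr_inv_sqrt_natC :
  ((Num.sqrt d%:R)^-1)%:C%C ^+ 2 = d%:R^-1 :> C.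
Proof.
by rewrite -rmorphXn exprVn sqr_sqrtr ?ler0n // fmorphV rmorph_nat.
Qed.

Lemma phi_plus_adjE (j : 'I_(1 * 1)) x : (phi_plus R d)^t* j x = phi_plus R d x j.
Proof.
rewrite [LHS]mxE [X in Num.conj X]mxE phi_plusE rmorphM.
congr (_ * _); last exact: conjC_nat.
by apply: conj_Creal; rewrite complex_real.
Qed.

Lemma PhiE x y : Phi R d x y = d%:R^-1 *
  (((mxtens_unindex x).1 == (mxtens_unindex x).2) &&
   ((mxtens_unindex y).1 == (mxtens_unindex y).2))%:R.
Proof.
rewrite /Phi mxE big_ord1 phi_plus_adjE !phi_plusE.
by rewrite mulrACA -expr2 sqr_inv_sqrt_natC -natrM mulnb.
Qed.

(** Transposing both factors is the full transpose, which fixes Phi because its entries are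
    symmetric in row and column. *)
Lemma ptmx_Phi a b :
  ptmx a b (Phi R d) = if a (+) b then d%:R^-1 *: flipmx else Phi R d.
Proof.
apply/matrixP=> x y; rewrite mxE PhiE !mxtens_indexK.
case: a; case: b; rewrite /= ?PhiE // ?mxE; congr (_ * (nat_of_bool _)%:R).
- by rewrite andbC.
- by rewrite andbC; congr (_ && _); rewrite eq_sym.
- by congr (_ && _); rewrite eq_sym.
Qed.

Lemma flipmx_adj : (flipmx : 'M[C]_(d * d))^t* = flipmx.
Proof.
apply/matrixP=> x y; rewrite !mxE conjC_nat andbC.
by congr (nat_of_bool (_ && _))%:R; rewrite eq_sym.
Qed.

Hypothesis d_gt0 : (0 < d)%N.

Lemma phi_plus_norm : (phi_plus R d)^t* *m phi_plus R d = 1%:M.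
Proof.
apply/matrixP=> i j; rewrite !ord1 [LHS]mxE [RHS]mxE eqxx.
under eq_bigr do rewrite phi_plus_adjE phi_plusE -expr2 exprMn sqr_inv_sqrt_natC.
rewrite -mulr_sumr (reindex (@mxtens_index d d)); last first.
  by exists (@mxtens_unindex d d) => ? _; rewrite ?mxtens_indexK ?mxtens_unindexK.
rewrite (eq_bigr (fun p : 'I_d * 'I_d => (p.1 == p.2)%:R)) => [|p _]; last first.
  by rewrite mxtens_indexK -natrX; case: (_ == _).
rewrite -(pair_bigA _ (fun a b : 'I_d => (a == b)%:R)) /=.
rewrite (eq_bigr (fun=> 1)) => [|a _]; last first.
  by rewrite (bigD1 a) //= eqxx big1 ?addr0 // => b; rewrite eq_sym => /negPf ->.
by rewrite sumr_const card_ord mulVf // pnatr_eq0 -lt0n.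
Qed.

Lemma Phi_proj : orthoproj (Phi R d).
Proof.
split; first by rewrite /Phi trmx_mul map_mxM /= trmxCK.
by rewrite /Phi mulmxA -[_ *m _ *m phi_plus R d]mulmxA phi_plus_norm mulmx1.
Qed.

Lemma mxtrace_Phi : \tr (Phi R d) = 1.
Proof. by rewrite /Phi mxtrace_mulC phi_plus_norm mxtrace1. Qed.

End EdgeOperators.

(* b tells Phi from I - Phi; on a cut edge, c tells the antisymmetric projector
   (coordinate 1 of R^2) from the symmetric one (coordinate 0). *)
Definition xcoef {K : pzRingType} (d : nat) (cut b c : bool) : K :=
  if cut then (if b then (-1) ^+ c else if c then d%:R + 1 else d%:R - 1)
  else (b == c)%:R.

(** Here [e] and [f] stand for one entry of I and of the flip F. This expands F/d and I - F/d over
    (I - F)/2 and (I + F)/2. *)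
Lemma flip_decomposition (K : numFieldType) d b (e f : K) : (0 < d)%N ->
  (if b then d%:R^-1 * f else e - d%:R^-1 * f) =
  d%:R^-1 * (xcoef d true b true * (2%:R^-1 * (e + (-1) ^+ true * f)) +
             xcoef d true b false * (2%:R^-1 * (e + (-1) ^+ false * f))).
Proof.
move=> d_gt0; have d0 : d%:R != 0 :> K by rewrite pnatr_eq0 -lt0n.
by case: b => /=; field.
Qed.

(** The denominators 1 and d^2 - 1 are the ranks of Phi and I - Phi. Dividing d - 1 or d + 1 by d^2
    - 1 leaves 1/(d + 1) or 1/(d - 1). *)
Lemma flip_dual (K : numFieldType) d c (e f : K) : (1 < d)%N ->
  xcoef d true true c / 1 * (d%:R^-1 * f) +
  xcoef d true false c / ((d * d)%:R - 1) * (e - d%:R^-1 * f) =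
  2%:R / (if c then d%:R - 1 else d%:R + 1) * (2%:R^-1 * (e + (-1) ^+ c * f)).
Proof.
move=> d_gt1; have d0 : d%:R != 0 :> K by rewrite pnatr_eq0 -lt0n ltnW.
have d1 : d%:R - 1 != 0 :> K by rewrite subr_eq0 pnatr_eq1 gtn_eqF.
have d2 : d%:R + 1 != 0 :> K by rewrite natr1 pnatr_eq0.
have dd : d%:R * d%:R - 1 != 0 :> K.
  by rewrite -expr2 subr_sqr_1 mulf_neq0.
by rewrite natrM; case: c => /=; field; rewrite ?d0 ?d1 ?d2 ?dd.
Qed.

(** * Local projectors on cut and uncut edges *)

Section LocalFamilies.
Context {R : realType} {d : nat}.
Local Notation C := R[i].

Lemma orthoproj_compl n (A : 'M[C]_n) : orthoproj A -> orthoproj (1%:M - A).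
Proof.
move=> [hA AA]; split.
  by rewrite linearB /= map_mxB hA trmx1 map_mx1.
by rewrite mulmxBl mul1mx mulmxBr mulmx1 AA subrr subr0.
Qed.

Definition phi_projmx (b : bool) : 'M[C]_(d * d) :=
  if b then Phi R d else 1%:M - Phi R d.

Definition flip_projmx (c : bool) : 'M[C]_(d * d) :=
  2%:R^-1 *: (1%:M + (-1) ^+ c *: flipmx).

Definition local_projmx (cut : bool) := if cut then flip_projmx else phi_projmx.

(** These separate entry rules leave the entries of [1%:M] and [flipmx] folded, so that they match
    the scalars [e] and [f] above. *)
Lemma scalemxE m n (a : C) (A : 'M[C]_(m, n)) i j : (a *: A) i j = a * A i j.
Proof. by rewrite mxE. Qed.

Lemma addmxE m n (A B : 'M[C]_(m, n)) i j : (A + B) i j = A i j + B i j.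
Proof. by rewrite mxE. Qed.

Lemma oppmxE m n (A : 'M[C]_(m, n)) i j : (- A) i j = - A i j.
Proof. by rewrite mxE. Qed.

Lemma flip_projmxE c x y :
  flip_projmx c x y = 2%:R^-1 * (1%:M x y + (-1) ^+ c * flipmx x y).
Proof. by rewrite /flip_projmx scalemxE addmxE scalemxE. Qed.

Lemma orthoproj_flip c : orthoproj (flip_projmx c).
Proof.
have s2 : ((-1) ^+ c * (-1) ^+ c = 1 :> C) by rewrite -expr2 sqrr_sign.
split.
  rewrite linearZ linearD linearZ /= map_mxZ map_mxD map_mxZ flipmx_adj.
  by rewrite trmx1 map_mx1 rmorph_sign fmorphV rmorph_nat.
rewrite /flip_projmx; set F : 'M[C]_(d * d) := _ *: flipmx.
have FF : F *m F = 1%:M.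
  by rewrite /F -scalemxAl -scalemxAr flipmxK !scalerA s2 scale1r.
(* Only F^2 = I matters from here: it gives (I + F)^2 = 2(I + F). *)
move: F FF => F FF.
rewrite -scalemxAl -scalemxAr mulmxDl mul1mx mulmxDr mulmx1 FF [F + _]addrC.
by rewrite -mulr2n -[(_ + _) *+ 2]scaler_nat scalerK // pnatr_eq0.
Qed.

Hypothesis d_ge2 : (2 <= d)%N.
Let d_gt0 : (0 < d)%N := ltnW d_ge2.

Lemma orthoproj_phi b : orthoproj (phi_projmx b).
Proof. by case: b; [|apply: orthoproj_compl]; apply: Phi_proj. Qed.

Lemma orthoproj_local x c : orthoproj (local_projmx x c).
Proof. by case: x; [apply: orthoproj_flip|apply: orthoproj_phi]. Qed.

Lemma mul_phi_projmx b c :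
  phi_projmx b *m phi_projmx c = (b == c)%:R *: phi_projmx b.
Proof.
have [_ PP] := Phi_proj (R := R) d_gt0.
case: eqP => [<-|]; first by rewrite scale1r; case: (orthoproj_phi b).
rewrite scale0r; case: b; case: c => //= _.
  by rewrite mulmxBr mulmx1 PP subrr.
by rewrite mulmxBl mul1mx PP subrr.
Qed.

Definition phi_rank (b : bool) : C := if b then 1 else (d * d)%:R - 1.

Lemma mxtrace_phi_projmx b : \tr (phi_projmx b) = phi_rank b.
Proof.
by case: b; rewrite /= ?linearB /= mxtrace_Phi // mxtrace1.
Qed.

Lemma phi_rank_gt0 b : 0 < phi_rank b.
Proof.
case: b; rewrite //= subr_gt0 ltr1n.
by apply: (leq_trans d_ge2); rewrite leq_pmulr.
Qed.

Lemma ptmx_phi_projE a a' b :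
  ptmx a a' (phi_projmx b) =
  if a (+) a' then (if b then d%:R^-1 *: flipmx else 1%:M - d%:R^-1 *: flipmx)
  else phi_projmx b.
Proof.
rewrite /phi_projmx; case: b; rewrite ?ptmxB ?ptmx1 ptmx_Phi //.
by case: ifP.
Qed.

(** Cut and uncut edges are put in one form, so that a tensor product over all edges can be expanded
    at once. *)
Lemma ptmx_phi_projmx a a' b :
  ptmx a a' (phi_projmx b) = (if a (+) a' then d%:R^-1 else 1) *:
    (xcoef d (a (+) a') b true *: local_projmx (a (+) a') true +
     xcoef d (a (+) a') b false *: local_projmx (a (+) a') false).
Proof.
rewrite ptmx_phi_projE; case: (a (+) a'); last first.
  by case: b; rewrite !scale1r !scale0r ?addr0 ?add0r.
apply/matrixP=> x y.
transitivity (if b then d%:R^-1 * flipmx x y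
              else (1%:M x y : C) - d%:R^-1 * flipmx x y).
  by case: (b); [rewrite scalemxE|rewrite addmxE oppmxE scalemxE].
rewrite [RHS]scalemxE [X in _ = _ * X]addmxE.
rewrite [X in _ = _ * (X + _)]scalemxE [X in _ = _ * (_ + X)]scalemxE.
rewrite [X in _ = _ * (_ * X + _)]flip_projmxE.
rewrite [X in _ = _ * (_ + _ * X)]flip_projmxE.
exact: flip_decomposition.
Qed.

(** On a cut edge, the factors 2/(d + 1) and 2/(d - 1) of the symmetric and antisymmetric
    projectors; on an uncut edge, the rank normalisation of the one surviving term. *)
Definition dual_coef (x c : bool) : C :=
  if x then 2%:R / (if c then d%:R - 1 else d%:R + 1) else (phi_rank c)^-1.

Lemma dual_coef_ge0 x c : 0 <= dual_coef x c.
Proof.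
case: x; last by rewrite invr_ge0 ltW ?phi_rank_gt0.
apply: divr_ge0; first exact: ler0n.
by case: c; rewrite ?subr_ge0 ?ler1n // addr_ge0 ?ler0n.
Qed.

(** Dual to [ptmx_phi_projmx]: the sum runs over Phi and I - Phi while the resulting projector [c]
    is fixed. *)
Lemma ptmx_phi_dual a a' c :
  xcoef d (a (+) a') true c / phi_rank true *: ptmx a a' (phi_projmx true) +
  xcoef d (a (+) a') false c / phi_rank false *: ptmx a a' (phi_projmx false) =
  dual_coef (a (+) a') c *: local_projmx (a (+) a') c.
Proof.
rewrite !ptmx_phi_projE; case: (a (+) a'); last first.
  by case: c; rewrite ?mul0r ?scale0r ?add0r ?addr0 ?mul1r.
apply/matrixP=> x y.
rewrite [LHS]addmxE [RHS]scalemxE [X in _ = _ * X]flip_projmxE.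
rewrite [X in X + _]scalemxE [X in _ + X]scalemxE [X in _ * X + _]scalemxE.
rewrite [X in _ + _ * X]addmxE [X in _ + _ * (_ + X)]oppmxE.
rewrite [X in _ + _ * (_ - X)]scalemxE.
exact: flip_dual.
Qed.

End LocalFamilies.

Arguments phi_rank {R} d b.
Arguments dual_coef {R} d x c.

(** * Product projectors on the network *)

Section NetworkOperators.
Context {R : realType} {V : finType} {adj : rel V} {d : nat}.
Hypothesis d_ge2 : (2 <= d)%N.
Implicit Types (S : {set V}) (T U : {set edge adj}).
Local Notation C := R[i].

Definition phi_tens T : netop R adj d := bigtens (fun e => phi_projmx (e \in T)).

(** One set [U] records two choices: the antisymmetric projector on cut edges and Phi on uncut
    ones. *)
Definition block_tens S U : netop R adj d :=
  bigtens (fun e => local_projmx (e \in cut adj S) (e \in U)).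

(** The uncut factors are Kronecker deltas forcing [T] and [U] to agree off the cut. The ring is
    generic because the weights occur both over the reals and over the complex numbers. *)
Definition cut_weight {K : comPzRingType} S T U : K :=
  \prod_e xcoef d (e \in cut adj S) (e \in T) (e \in U).

Definition phi_tens_rank T : C := \prod_e phi_rank d (e \in T).

Lemma rmorph_cut_weight (K L : comPzRingType) (f : {rmorphism K -> L}) S T U :
  f (cut_weight S T U) = cut_weight S T U.
Proof.
rewrite rmorph_prod; apply: eq_bigr => e _; rewrite /xcoef.
case: (_ \in cut _ _); last exact: rmorph_nat.
case: (e \in T); first exact: rmorph_sign.
case: (e \in U); first by rewrite rmorphD /= rmorph_nat rmorph1.
by rewrite rmorphB /= rmorph_nat rmorph1.
Qed.

Lemma orthoproj_phi_tens T : orthoproj (phi_tens T).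
Proof. by apply: orthoproj_bigtens => e; apply: orthoproj_phi. Qed.

Lemma orthoproj_block_tens S U : orthoproj (block_tens S U).
Proof. by apply: orthoproj_bigtens => e; apply: orthoproj_local. Qed.

Lemma phi_tens_rank_gt0 T : 0 < phi_tens_rank T.
Proof. by apply: prodr_gt0 => e _; apply: phi_rank_gt0. Qed.

Lemma mxtrace_phi_tens T : \tr (phi_tens T) = phi_tens_rank T.
Proof.
by rewrite mxtrace_bigtens; apply: eq_bigr => e _; rewrite mxtrace_phi_projmx.
Qed.

(** Distinct sets differ at some edge, where the product of Phi and I - Phi vanishes. *)
Lemma mul_phi_tens T T' :
  phi_tens T *m phi_tens T' = (T == T')%:R *: phi_tens T.
Proof.
rewrite bigtens_mul.
rewrite (eq_bigtens
  (B := fun e => ((e \in T) == (e \in T'))%:R *: phi_projmx (e \in T))).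
  rewrite bigtensZ; congr (_ *: _).
  case: eqP => [->|ne]; first by rewrite big1 // => e _; rewrite eqxx.
  have [e he] := set_neqP ne.
  by rewrite (bigD1 e) //= (negPf he) mul0r.
by move=> e; rewrite mul_phi_projmx.
Qed.

Lemma mem_cut S (e : edge adj) :
  (e \in cut adj S) = ((val e).1 \in S) (+) ((val e).2 \in S).
Proof. by rewrite inE. Qed.

Lemma ptrans_phi_tens S T : ptrans S (phi_tens T) =
  (\prod_(e : edge adj) if e \in cut adj S then d%:R^-1 else 1) *:
    \sum_U cut_weight S T U *: block_tens S U.
Proof.
rewrite ptrans_bigtens.
under eq_bigtens => e do rewrite ptmx_phi_projmx // -mem_cut.
rewrite bigtensZ; congr (_ *: _).
rewrite (bigtens_sum_bool (fun e c => xcoef d (e \in cut adj S) (e \in T) c *: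
  local_projmx (e \in cut adj S) c)).
by apply: eq_bigr => U _; rewrite bigtensZ.
Qed.

(** The product over all edges of [ptmx_phi_dual], expanded by distributivity. *)
Lemma sum_ptrans_phi_tens S U :
  \sum_T (cut_weight S T U / phi_tens_rank T) *: ptrans S (phi_tens T) =
  (\prod_(e : edge adj) dual_coef d (e \in cut adj S) (e \in U)) *:
    block_tens S U.
Proof.
rewrite -bigtensZ; under [RHS]eq_bigtens => e do
  rewrite mem_cut -ptmx_phi_dual // -mem_cut.
rewrite (bigtens_sum_bool (fun e b =>
  (xcoef d (e \in cut adj S) b (e \in U) / phi_rank d b) *:
  ptmx ((val e).1 \in S) ((val e).2 \in S) (phi_projmx b))).
apply: eq_bigr => T _; rewrite bigtensZ ptrans_bigtens; congr (_ *: _).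
by rewrite big_split /= prodfV.
Qed.

(** The weight vanishes unless [T] agrees with [T'] off the cut, so the sum over all sets reduces to
    the sum over subsets of the cut. *)
Lemma cut_sumE (K : comPzRingType) S T' U (F : {set edge adj} -> K) :
  T' \subset ~: cut adj S ->
  \sum_(T : {set edge adj} | T \subset cut adj S)
     F (T :|: T') * \prod_(e in cut adj S) xcoef d true (e \in T) (e \in U) =
  \sum_T F T * cut_weight S T ((U :&: cut adj S) :|: T').
Proof.
move=> sT'.
have memT' e : e \in cut adj S -> (e \in T') = false.
  by move=> he; apply/negbTE; apply: contraL he => /(subsetP sT'); rewrite inE.
have wE T : cut_weight S T ((U :&: cut adj S) :|: T') =
    (T :\: cut adj S == T')%:R *
    \prod_(e in cut adj S) xcoef d true (e \in T) (e \in U) :> K.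
  rewrite /cut_weight (bigID (fun e => e \in cut adj S)) /= mulrC; congr (_ * _).
    case: eqP => [<-|ne].
      rewrite big1 // => e /negPf he.
      by rewrite /xcoef he in_setU in_setI in_setD he andbF /= eqxx.
    have [e he] := set_neqP ne.
    have ec : e \notin cut adj S.
      by apply/negP => ec; move: he; rewrite inE ec memT'.
    rewrite (bigD1 e) //= /xcoef (negPf ec) in_setU in_setI (negPf ec) andbF /=.
    by move: he; rewrite in_setD ec /= => /negPf ->; rewrite mul0r.
  by apply: eq_bigr => e ec; rewrite ec in_setU in_setI ec andbT memT' // orbF.
under [RHS]eq_bigr => T _ do rewrite wE.
rewrite [RHS](bigID (fun T => T :\: cut adj S == T')) /=.
rewrite [X in _ = _ + X]big1; last first.
  by move=> T /negPf ->; rewrite mul0r mulr0.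
rewrite addr0.
(* The surviving sets are the unions of [T'] with a subset of the cut, recovered by intersecting
   with the cut. *)
rewrite [RHS](reindex_onto (fun T => T :|: T')
  (fun T => T :&: cut adj S)); last first.
  by move=> T /eqP <-; rewrite setID.
apply: eq_big => [T|T sT].
  apply/idP/andP => [sT|[_ /eqP <-]]; last exact: subsetIr.
  split; apply/eqP/setP => e; rewrite !inE -mem_cut.
    case ec : (e \in cut adj S); first by rewrite memT'.
    by rewrite (contraFF (subsetP sT e) ec).
  case ec : (e \in cut adj S); first by rewrite memT' // orbF andbT.
  by rewrite andbF (contraFF (subsetP sT e) ec).
have -> : (T :|: T') :\: cut adj S == T'.
  apply/eqP/setP => e; rewrite !inE -mem_cut.
  case ec : (e \in cut adj S); first by rewrite memT'.
  by rewrite (contraFF (subsetP sT e) ec).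
rewrite mul1r; congr (_ * _); apply: eq_bigr => e ec.
by rewrite in_setU memT' // orbF.
Qed.

End NetworkOperators.

Arguments cut_weight {V adj} d {K} S T U.
Arguments phi_tens_rank {R V adj} d T.

(** * The inequalities of the theorem, indexed by sets of edges *)

Section CutCondition.
Context {R : realType} {V : finType} {adj : rel V} {d : nat}.
Variable S : {set V}.
Implicit Types (T U : {set edge adj}).

(** Turns a column label of [xvec] into the set of cut edges carrying coordinate 1, that of the
    antisymmetric projector. *)
Definition antisym_edges (f : {ffun {e : edge adj | e \in cut adj S} -> 'I_2}) :
    {set edge adj} := [set val k | k in [set k | f k != 0]].

Lemma mem_antisym_edges f (k : {e : edge adj | e \in cut adj S}) :
  (val k \in antisym_edges f) = (f k != 0).
Proof. by rewrite mem_imset ?inE //; apply: val_inj. Qed.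

Lemma xvecE T i j : xvec R d S T i j =
  \prod_(e in cut adj S)
    xcoef d true (e \in T) (e \in antisym_edges (enum_val j)).
Proof.
rewrite mxE [RHS]big_sub; apply: eq_bigr => k _; rewrite mem_antisym_edges /xcoef.
by case: ifP => _; rewrite mxE; case: eqP.
Qed.

(** The part of [U] inside the cut names a component of the vectors, and the part outside serves as
    [T']. *)
Lemma cut_conditionE (q : {set edge adj} -> R) :
  (forall T' : {set edge adj}, T' \subset ~: cut adj S -> forall i j,
     0 <= (\sum_(T : {set edge adj} | T \subset cut adj S)
             q (T :|: T') *: xvec R d S T) i j) <->
  forall U, 0 <= \sum_T q T * cut_weight d S T U.
Proof.
have sumE (T' : {set edge adj}) i j : T' \subset ~: cut adj S ->
    (\sum_(T : {set edge adj} | T \subset cut adj S)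
       q (T :|: T') *: xvec R d S T) i j =
    \sum_T q T *
      cut_weight d S T ((antisym_edges (enum_val j) :&: cut adj S) :|: T').
  move=> sT'; rewrite -cut_sumE // summxE; apply: eq_bigr => T _.
  by rewrite mxE xvecE.
split=> [h U|h T' sT' i j]; last by rewrite sumE.
pose f : {ffun {e : edge adj | e \in cut adj S} -> 'I_2} :=
  [ffun k => if val k \in U then 1 else 0].
have sU : U :\: cut adj S \subset ~: cut adj S by rewrite setDE subsetIr.
(* The row index is the only one, rows being labelled by families in ['I_1]. *)
have := h _ sU (enum_rank [ffun=> 0]) (enum_rank f).
rewrite sumE // enum_rankK.
suff -> : antisym_edges f :&: cut adj S = U :&: cut adj S by rewrite setID.
apply/setP=> e; rewrite !in_setI.
case: (boolP (e \in cut adj S)) => ec; rewrite ?andbF // !andbT.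
have -> : e = val (Sub e ec : {e : edge adj | e \in cut adj S}) by [].
by rewrite mem_antisym_edges ffunE; case: (_ \in U).
Qed.

End CutCondition.

(** * Decompositions versus cut inequalities *)

Section Decomposability.
Context {R : realType} {V : finType} {adj : rel V} {d : nat}.
Hypothesis d_ge2 : (2 <= d)%N.
Implicit Types (w q : {set edge adj} -> R) (S : {set V}).
Local Notation C := R[i].

Lemma subsym_opE w : subsym_op d w = \sum_T (w T)%:C%C *: phi_tens T.
Proof. by []. Qed.

Lemma ptrans_subsym_op w S :
  ptrans S (subsym_op d w) =
  \sum_U ((\prod_(e : edge adj) if e \in cut adj S then d%:R^-1 else 1) *
           (\sum_T w T * cut_weight d S T U)%:C%C) *: block_tens S U.
Proof.
rewrite subsym_opE ptrans_sumZ.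
under eq_bigr => T _ do
  rewrite ptrans_phi_tens // scalerA mulrC -scalerA scaler_sumr.
rewrite -scaler_sumr exchange_big scaler_sumr; apply: eq_bigr => U _.
rewrite -scalerA rmorph_sum scaler_suml; congr (_ *: _).
by apply: eq_bigr => T _; rewrite rmorphM rmorph_cut_weight scalerA.
Qed.

(** Both operators are combinations of orthogonal projectors: the coefficients of [P] are
    nonnegative by [q T <= w T], those of [Q] by the cut inequalities. *)
Lemma decomposition_of_cut_condition w q S :
  (forall T, q T <= w T) -> (forall U, 0 <= \sum_T q T * cut_weight d S T U) ->
  exists P Q : netop R adj d,
    [/\ psdmx P, psdmx Q & subsym_op d w = P + ptrans S Q].
Proof.
move=> qw q0.
exists (\sum_T (w T - q T)%:C%C *: phi_tens T), (ptrans S (subsym_op d q)); split.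
- apply: psdmx_sum_orthoproj => T; last exact: orthoproj_phi_tens.
  by rewrite ler0c subr_ge0.
- rewrite ptrans_subsym_op; apply: psdmx_sum_orthoproj => U.
    apply: mulr_ge0; last by rewrite ler0c.
    by apply: prodr_ge0 => e _; case: ifP => _; rewrite ?invr_ge0 ?ler0n ?ler01.
  exact: orthoproj_block_tens.
- rewrite ptransK !subsym_opE -big_split /=; apply: eq_bigr => T _.
  by rewrite -scalerDl -rmorphD subrK.
Qed.

Lemma mxtrace_subsym_op w T :
  \tr (subsym_op d w *m phi_tens T) = (w T)%:C%C * phi_tens_rank d T.
Proof.
rewrite subsym_opE mulmx_suml (bigD1 T) //= big1 => [|T' ne].
  rewrite addr0 -scalemxAl mul_phi_tens // eqxx scale1r linearZ /=.
  by rewrite mxtrace_phi_tens.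
by rewrite -scalemxAl mul_phi_tens // (negPf ne) scale0r scaler0.
Qed.

Lemma cut_condition_of_decomposition w S (P Q : netop R adj d) :
  psdmx P -> psdmx Q -> subsym_op d w = P + ptrans S Q ->
  exists q : {set edge adj} -> R, (forall T, q T <= w T) /\
    forall U, 0 <= \sum_T q T * cut_weight d S T U.
Proof.
move=> P0 Q0 WE.
pose p T : C := \tr (P *m phi_tens T) / phi_tens_rank d T.
pose c T : C := \tr (ptrans S Q *m phi_tens T) / phi_tens_rank d T.
have pc T : (w T)%:C%C = p T + c T.
  rewrite /p /c -mulrDl -mxtraceD -mulmxDl -WE mxtrace_subsym_op mulfK //.
  by rewrite gt_eqF // phi_tens_rank_gt0.
have p0 T : 0 <= p T.
  apply: divr_ge0; last exact/ltW/phi_tens_rank_gt0.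
  by apply: mxtrace_psd_orthoproj => //; apply: orthoproj_phi_tens.
(* [c T] is real, being the difference of the reals [w T] and [p T], so [Re] loses nothing. *)
exists (fun T => complex.Re (c T)); split=> [T|U].
  have := p0 T; rewrite lecE => /andP[_ /=].
  have /(congr1 (@complex.Re _)) := pc T.
  by case: (p T) (c T) => [a b] [a' b'] /= ->; rewrite lerDr.
have : 0 <= \sum_T c T * cut_weight d S T U.
  (* Gamma_S moves from [Q] to the projectors, whose weighted sum is a nonnegative multiple of a
     single product projector. *)
  have -> : \sum_T c T * cut_weight d S T U = \tr (Q *m
     \sum_T (cut_weight d S T U / phi_tens_rank d T) *: ptrans S (phi_tens T)).
    rewrite mulmx_sumr raddf_sum; apply: eq_bigr => T _.
    rewrite -scalemxAr [RHS]mxtraceZ -mxtrace_ptrans /c.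
    by rewrite [LHS]mulrC -[RHS]mulrA; congr (_ * _); apply: mulrC.
  rewrite sum_ptrans_phi_tens // -scalemxAr mxtraceZ; apply: mulr_ge0.
    by apply: prodr_ge0 => e _; apply: dual_coef_ge0.
  by apply: mxtrace_psd_orthoproj => //; apply: orthoproj_block_tens.
rewrite lecE => /andP[_].
suff -> : complex.Re (\sum_T c T * cut_weight d S T U) =
   \sum_T complex.Re (c T) * cut_weight d S T U by [].
elim/big_rec2: _ => // T x y _ <-.
(* The complex weight is the image of the real one, so it can be taken out of [Re]. *)
rewrite -(rmorph_cut_weight (real_complex R)).
by case: (c T) y => [a b] [a' b'] /=; rewrite mulr0 subr0.
Qed.

End Decomposability.

Theorem mainTheorem1 (R : realType) (V : finType) (adj : rel V)
    (adj_sym : symmetric adj) (adj_irr : irreflexive adj)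
    (adj_conn : forall u v : V, connect adj u v) (cardV : (2 <= #|V|)%N)
    (d : nat) (d_ge2 : (2 <= d)%N) (w : {set edge adj} -> R) :
  is_SSW (subsym_op d w) <->
  forall S : {set V}, nontrivial S ->
    exists q : {set edge adj} -> R,
      (forall T : {set edge adj}, q T <= w T) /\
      (forall T' : {set edge adj}, T' \subset ~: cut adj S ->
        forall i j,
          0 <= (\sum_(T : {set edge adj} | T \subset cut adj S)
                  q (T :|: T') *: xvec R d S T) i j).
Proof.
split=> [[[_ dec] _] S /dec [P [Q [P0 Q0 WE]]]|h].
  have [q [qw q0]] := cut_condition_of_decomposition d_ge2 P0 Q0 WE.
  by exists q; split=> //; apply/cut_conditionE.
split; last by exists w.
split; last first.
  move=> S /h [q [qw /cut_conditionE q0]].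
  exact: decomposition_of_cut_condition qw q0.
rewrite subsym_opE; apply: hermsymmx_sum_orthoproj => T.
  by rewrite complex_real.
exact: orthoproj_phi_tens.
Qed.
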